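(* Let $FCFS$ and $PR$ be the first-come-first-served and Primal Routing algorithms based on the same CDLP solution $x^*$. Then for every state $(c,t)$, $$V^{PR}(c,t)\ \ge\ V^{FCFS}(c,t).$$
   Context: **Model.** The horizon is $[0,1]$. There are $L$ resources, $N$ products and $K$ customer types. Resource $l$ has initial integer capacity $C_l$. Product $n\in\{1,\dots,N\}$ uses one unit of a single resource $l_n$ and earns reward $r_n$; $N_l=\{n:l_n=l\}$. Product $0$ is the no-purchase option, $r_0=0$. An assortment is a subset of $\{0,\dots,N\}$ containing $0$; $\mathcal S$ is the set of all assortments. Type-$k$ customers arrive according to independent non-homogeneous Poisson processes with known integrable rates $\lambda_k(t)\ge0$; $\Lambda_k=\int_0^1\lambda_k(s)ds$. A type-$k$ customer offered $S$ chooses exactly one $n\in S$, product $n$ with probability $P^k(n,S)$ ($\sum_{n\in S}P^k(n,S)=1$), independently of everything else given type and offered assortment. The state $(c,t)$ consists of the remaining inventory vector $c=(c_1,\dots,c_L)$, $c_l\in\{0,\dots,C_l\}$, and the time $t\in[0,1]$; $e_l$ is the $l$-th unit vector. **CDLP.** $x^*=(x_k^*(S))$ is a fixed ($\epsilon$-optimal) feasible solution of: maximize $\sum_k\sum_{S\in\mathcal S}\Lambda_kx_k(S)\sum_{n\in S}P^k(n,S)r_n$ subject to $\sum_k\Lambda_k\sum_{n\in N_j}\sum_{S\in\mathcal S:n\in S}x_k(S)P^k(n,S)\le C_j$ for all $j$; $\sum_{S\in\mathcal S}x_k(S)\le1$ for all $k$; $x_k(S)\ge0$. $A_k^{Static}$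 is a random assortment with $P(A_k^{Static}=S)=x_k^*(S)$ (with any remaining probability it is $\{0\}$), drawn for each arriving type-$k$ customer independently of the time, inventory and all else. **Notation.** $\Delta_lV(c,t)=V(c,t)-V(c-e_l,t)$ if $c_l>0$ and $\infty$ if $c_l=0$. For a (possibly random) assortment $S$, $R_t^{kl}(S,z)=\lambda_k(t)\sum_{n\in N_l}\mathbf E[\mathbf 1(n\in S)P^k(n,S)](r_n-z)$ and $\mathcal R_t^{kl}(S,z)=\lambda_k(t)\sum_{n\in N_l}\mathbf E[\mathbf 1(n\in S)P^k(n,S)][r_n-z]^+$, with $[r_n-\infty]^+=0$ and $0\cdot\infty=0$. Differential equations are for functions absolutely continuous in $t$, for almost every $t$. Under both algorithms assortments may contain out-of-stock products and choices are unaffected by inventory (static substitution). **FCFS.** Offer each type-$k$ arrival the assortment $A_k^{Static}$. If the customer chooses $n\ge1$, the customer purchases it (earning $r_n$ and depleting one unit of resource $l_n$) if resource $l_n$ has positive remaining inventory; otherwise the customer is rejected. Its expected future reward $V^{FCFS}(c,t)$ from state $(c,t)$ satisfies $$\frac{\partial V^{FCFS}(c,t)}{\partial t}=-\sum_{k=1}^K\sum_{l=1}^L\mathbf 1(c_l>0)R_t^{kl}(A_k^{Static},\Delta_lV^{FCFS}(c,t)),\qquad V^{FCFS}(0,t)=0,\ V^{FCFS}(\cdot,1)=0.$$ **PR.** Offer each type-$k$ arrival the assortment $A_k^{Static}$. If at state $(c,t)$ the customer chooses $n\ge1$ with $l=l_n$, the customer purchases it if and only if $c_l>0$ and $r_n\ge\Delta_lV^{PR}(c,t)$;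 otherwise the customer is rejected (no reward, no change in inventory). Here $V^{PR}(c,t)$ is the expected future reward of $PR$ from state $(c,t)$, determined by $$\frac{\partial V^{PR}(c,t)}{\partial t}=-\sum_{k=1}^K\sum_{l=1}^L\mathcal R_t^{kl}(A_k^{Static},\Delta_lV^{PR}(c,t)),\qquad V^{PR}(0,t)=0,\ V^{PR}(\cdot,1)=0.$$ *)

(* Defs.v *)
From HB Require Import structures.
From mathcomp Require Import all_boot all_order all_algebra.
From mathcomp Require Import all_classical all_reals all_analysis.

Set Implicit Arguments.
Unset Strict Implicit.
Unset Printing Implicit Defensive.

Import Order.TTheory GRing.Theory Num.Theory.
Import numFieldNormedType.Exports.

Local Open Scope ring_scope.

(* Products are 'I_N.+1, with ord0 the no-purchase option; the genuine
   products 1, ..., N are the [lift ord0 i] for i : 'I_N. *)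
Definition assortment (N : nat) := {S : {set 'I_N.+1} | ord0 \in S}.

Definition empty_assortment (N : nat) : assortment N :=
  exist _ [set ord0] (set11 ord0).

(* Rewards may be negative; [choice k n S] is only meaningful for n in S. *)
Record model (R : realType) (L N K : nat) := Model {
  capacity : 'I_L -> nat;
  resource : 'I_N -> 'I_L;
  reward : 'I_N.+1 -> R;
  reward0 : reward ord0 = 0;
  rate : 'I_K -> R -> R;
  rate_ge0 : forall k (t : R), 0 <= t <= 1 -> 0 <= rate k t;
  rate_integrable : forall k,
    (@lebesgue_measure R).-integrable `[0, 1]%classic (EFin \o rate k);
  choice : 'I_K -> 'I_N.+1 -> assortment N -> R;
  choice_ge0 : forall k n (S : assortment N), n \in val S -> 0 <= choice k n S;
  choice_sum1 : forall k (S : assortment N),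
    \sum_(n in val S) choice k n S = 1 }.

Section Definitions.
Context (R : realType) (L N K : nat) (M : model R L N K).

Definition products_of (l : 'I_L) : {set 'I_N.+1} :=
  [set lift ord0 i | i in 'I_N & resource M i == l].

Definition total_rate (k : 'I_K) : R :=
  Rintegral (@lebesgue_measure R) `[0, 1]%classic (rate M k).

Definition cdlp_objective (x : 'I_K -> assortment N -> R) : R :=
  \sum_k \sum_S total_rate k * x k S *
    \sum_(n in val S) choice M k n S * reward M n.

Definition cdlp_feasible (x : 'I_K -> assortment N -> R) : Prop :=
  [/\ forall j, \sum_k total_rate k *
        (\sum_(n in products_of j)
           \sum_(S : assortment N | n \in val S) x k S * choice M k n S)
        <= (capacity M j)%:R,
      forall k, \sum_S x k S <= 1
    & forall k S, 0 <= x k S].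

Definition cdlp_eps_optimal (eps : R) (x : 'I_K -> assortment N -> R) : Prop :=
  cdlp_feasible x /\
  forall y, cdlp_feasible y -> cdlp_objective y <= cdlp_objective x + eps.

(* A random assortment is represented by its probability mass function.  The
   mass left over by x k is added to that of {0}. *)
Definition A_static (x : 'I_K -> assortment N -> R) (k : 'I_K)
    (S : assortment N) : R :=
  x k S + (S == empty_assortment N)%:R * (1 - \sum_T x k T).

(* E[1(n \in S) P^k(n, S)] for S distributed according to A *)
Definition choice_prob (k : 'I_K) (A : assortment N -> R) (n : 'I_N.+1) : R :=
  \sum_(S : assortment N | n \in val S) A S * choice M k n S.

(* In \bar R, r - +oo = -oo, maxe (-oo) 0 = 0 and 0 * -oo = 0. *)
Definition Rrate (k : 'I_K) (l : 'I_L) (t : R) (A : assortment N -> R)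
    (z : \bar R) : \bar R :=
  ((rate M k t)%:E * \sum_(n in products_of l)
     (choice_prob k A n)%:E * ((reward M n)%:E - z))%E.

Definition Rrate_pos (k : 'I_K) (l : 'I_L) (t : R) (A : assortment N -> R)
    (z : \bar R) : \bar R :=
  ((rate M k t)%:E * \sum_(n in products_of l)
     (choice_prob k A n)%:E * maxe ((reward M n)%:E - z) 0)%E.

Definition inventory := {ffun 'I_L -> nat}.

Definition is_state (c : inventory) : Prop := forall l, (c l <= capacity M l)%N.

Definition deplete (c : inventory) (l : 'I_L) : inventory :=
  [ffun j => (c j - (j == l))%N].

Definition Delta (V : inventory -> R -> R) (l : 'I_L) (c : inventory) (t : R)
    : \bar R :=
  if (0 < c l)%N then (V c t - V (deplete c l) t)%:E else +oo%E.

Definition abs_continuous (a b : R) (f : R -> R) : Prop :=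
  forall eps : R, 0 < eps -> exists2 delta : R, 0 < delta &
    forall (m : nat) (u v : 'I_m -> R),
      (forall i, a <= u i /\ u i <= v i /\ v i <= b) ->
      (forall i j, i != j -> v i <= u j \/ v j <= u i) ->
      \sum_i (v i - u i) < delta ->
      \sum_i `|f (v i) - f (u i)| < eps.

(* V is a solution on [0, 1] of  dV(c, t)/dt = - F V c t,  V(0, t) = 0,
   V(c, 1) = 0. *)
Definition value_ode
    (F : (inventory -> R -> R) -> inventory -> R -> \bar R)
    (V : inventory -> R -> R) : Prop :=
  [/\ forall c, is_state c -> abs_continuous 0 1 (V c),
      forall c, is_state c ->
        {ae @lebesgue_measure R, forall t : R, t \in `]0, 1[ ->
           derivable (V c) t 1 /\ ('D_1 (V c) t)%:E = (- F V c t)%E},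
      forall t : R, 0 <= t <= 1 -> V [ffun=> 0%N] t = 0
    & forall c, is_state c -> V c 1 = 0].

Definition is_FCFS_value (x : 'I_K -> assortment N -> R)
    (V : inventory -> R -> R) : Prop :=
  value_ode (fun V c t => \sum_(k < K) \sum_(l < L)
    (0 < c l)%N%:R%:E * Rrate k l t (A_static x k) (Delta V l c t))%E V.

Definition is_PR_value (x : 'I_K -> assortment N -> R)
    (V : inventory -> R -> R) : Prop :=
  value_ode (fun V c t => \sum_(k < K) \sum_(l < L)
    Rrate_pos k l t (A_static x k) (Delta V l c t))%E V.

End Definitions.

(* Main.v *)
(* By induction on the total inventory, D = V_FCFS - V_PR is nonpositive at all
   depleted states. At almost every time where D(c, t) > 0, the opportunity
   costs under FCFS then exceed those under PR, and since PR earns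
   [r_n - Delta]^+ >= r_n - Delta the two equations give D' >= 0. If D(c, t) > 0,
   absolute continuity makes D(c, .) nondecreasing from t up to its next zero,
   which exists because D(c, 1) = 0: a contradiction. *)
Require Import Defs.
From mathcomp Require Import all_boot all_order all_algebra.
From mathcomp Require Import all_classical all_reals all_analysis.
From mathcomp Require Import lra.
Import Order.TTheory GRing.Theory Num.Theory.
Import numFieldNormedType.Exports.
Local Open Scope classical_set_scope.
Local Open Scope ring_scope.

(** * Induction along a real interval and local growth *)

(** The step, applied at the supremum of the points of [[a, b]] satisfying [P], carries [P] from a
    point just left of it to one beyond it, unless [b] is reached first. *)
Lemma real_induction (R : realType) (a b : R) (P : R -> Prop) :
  a <= b -> P a ->
  (forall x, a <= x <= b -> exists2 d : R, 0 < d & forall s s',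
     P s -> a <= s <= x -> x <= s' <= b -> x - s < d -> s' - x < d -> P s') ->
  P b.
Proof.
move=> leab Pa step; pose A := [set s | a <= s <= b /\ P s].
have Aa : A a by split; rewrite // lexx.
have supA : has_sup A by split; [exists a | exists b => s [/andP[]]].
have xab : a <= sup A <= b.
  by rewrite (sup_upper_bound supA)//= ge_sup//; [exists a | move=> s [/andP[]]].
have [d d0 dP] := step _ xab.
have /andP[ax xb] := xab.
have [s As sx] := sup_adherent d0 supA.
have sle := sup_upper_bound supA As; case: As => /andP[le_as _] Ps.
(* If [sup A + d / 2] overshoots [b], the step lands directly on [b]; otherwise it puts that point
   in [A], above the supremum. *)
case: (leP (sup A + d / 2) b) => hb; last by apply: (dP s) => //; lra.
suff : A (sup A + d / 2) by move/(sup_upper_bound supA); lra.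
by split; [lra | apply: (dP s) => //; lra].
Qed.

(** Near [x] the difference quotients based at [x] exceed [- e], and the bounds on [[s, x]] and
    [[x, s']] add up; this is why [s] and [s'] must straddle [x]. *)
Lemma ge0_derive_local_growth (R : realType) (f : R -> R) (x e : R) :
  derivable f x 1 -> 0 <= 'D_1 f x -> 0 < e ->
  exists2 d : R, 0 < d & forall s s', s <= x <= s' -> x - s < d -> s' - x < d ->
    - e * (s' - s) <= f s' - f s.
Proof.
move=> df f'ge0 e0.
have : \forall h \near 0^', - e < h^-1 *: ((f \o shift x) (h *: 1) - f x).
  by apply: (cvgr_gt _ df); apply: lt_le_trans f'ge0; rewrite oppr_lt0.
case/nbhs_ballP => d /= d0 dP; exists d => // s s' /andP[sx xs'] hs hs'.
have quot y : y != x -> `|y - x| < d -> - e < (y - x)^-1 * (f y - f x).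
  move=> yx yd; have := dP (y - x); rewrite /= -ball_normE /= sub0r normrN.
  by rewrite subr_eq0 => /(_ yd yx); rewrite /shift /= [_ *: 1]mulr1 subrK.
have right_growth : - e * (s' - x) <= f s' - f x.
  case: (eqVneq s' x) => [->|ne]; first by rewrite !subrr mulr0.
  have lt : 0 < s' - x by rewrite subr_gt0 lt_neqAle eq_sym ne.
  have := quot s' ne; rewrite gtr0_norm// => /(_ hs').
  by rewrite mulrC ltr_pdivlMr// => /ltW.
have left_growth : - e * (x - s) <= f x - f s.
  case: (eqVneq s x) => [->|ne]; first by rewrite !subrr mulr0.
  have lt : 0 < x - s by rewrite subr_gt0 lt_neqAle ne.
  have := quot s ne; rewrite distrC gtr0_norm// => /(_ hs).
  rewrite mulrC -[f s - _]opprB -[s - x]opprB invrN mulrNN.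
  by rewrite ltr_pdivlMr// => /ltW.
lra.
Qed.

(** * Absolute continuity and monotonicity from an almost everywhere nonnegative derivative *)

Lemma abs_continuousB (R : realType) (a b : R) (f g : R -> R) :
  abs_continuous a b f -> abs_continuous a b g -> abs_continuous a b (f - g).
Proof.
move=> acf acg e e0; have e20 : 0 < e / 2 by rewrite divr_gt0.
have [d1 d10 hf] := acf _ e20; have [d2 d20 hg] := acg _ e20.
exists (Num.min d1 d2) => [|m u v uv disj]; first by rewrite lt_min d10.
rewrite lt_min => /andP[s1 s2].
have := ltrD (hf m u v uv disj s1) (hg m u v uv disj s2).
rewrite -splitr -big_split/=; apply: le_lt_trans; apply: ler_sum => i _.
rewrite !fctE (_ : _ - _ = (f (v i) - f (u i)) - (g (v i) - g (u i))); last by lra.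
exact: ler_normB.
Qed.

Lemma abs_continuous_sub (R : realType) (a b a' b' : R) (f : R -> R) :
  a <= a' -> b' <= b -> abs_continuous a b f -> abs_continuous a' b' f.
Proof.
move=> aa' b'b acf e /acf[d d0 h]; exists d => // m u v uv; apply: h => i.
by have [? [? ?]] := uv i; split; [|split=> //]; lra.
Qed.

Lemma abs_continuous_dist (R : realType) (a b : R) (f : R -> R) :
  abs_continuous a b f -> forall e, 0 < e -> exists2 d : R, 0 < d &
    forall s s', a <= s -> s <= s' -> s' <= b -> s' - s < d ->
      `|f s' - f s| < e.
Proof.
move=> acf e /acf[d d0 h]; exists d => // s s' as_ ss' s'b ds.
have := h 1%N (fun=> s) (fun=> s'); rewrite !big_ord1; apply=> // i j.
by rewrite !ord1 eqxx.
Qed.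

(* The sum of the increments of [f] over subintervals of [U], which absolute
   continuity makes small when [U] is small, absorbs the decrease of [f] near
   the points where [f] has no nonnegative derivative. *)
Definition growth_witness (R : realType) (U : set R) (f : R -> R) (e a s : R) :=
  exists (m : nat) (u v : nat -> R),
    [/\ forall i, (i < m)%N -> a <= u i /\ u i <= v i /\ v i <= s,
        forall i j, (i < j < m)%N -> v i <= u j,
        ((\sum_(i < m) (v i - u i))%:E <= lebesgue_measure (U `&` `[a, s[))%E
      & - e * (s - a) - \sum_(i < m) `|f (v i) - f (u i)| <= f s - f a].

(** The same intervals serve for [s']: the slope term alone pays for the change of [f] on
    [[s, s']]. *)
Lemma growth_witness_step_out (R : realType) (U : set R) (f : R -> R)
    (e a s s' : R) : open U -> s <= s' ->
  - e * (s' - s) <= f s' - f s ->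
  growth_witness R U f e a s -> growth_witness R U f e a s'.
Proof.
move=> oU ss' fs [m [u [v [uv dis me gr]]]]; exists m, u, v; split => //.
- by move=> i /uv[? [? ?]]; split=> //; split=> //; lra.
- apply: le_trans me _; apply: le_measure; rewrite ?inE//.
  + by apply: measurableI => //; exact: measurable_realfun.open_measurable.
  + by apply: measurableI => //; exact: measurable_realfun.open_measurable.
  + apply: setIS => x /=; rewrite !in_itv/= => /andP[-> xs].
    exact: lt_le_trans ss'.
- lra.
Qed.

(** The interval [[s, s']] is appended to the family. Its length is paid for by [[s, s'[], which
    lies in [U] and is disjoint from [[a, s[]. *)
Lemma growth_witness_step_in (R : realType) (U : set R) (f : R -> R)
    (e a s s' : R) : open U -> 0 <= e -> a <= s -> s <= s' ->
  `[s, s'[ `<=` U ->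
  growth_witness R U f e a s -> growth_witness R U f e a s'.
Proof.
move=> oU e0 as_ ss' sU [m [u [v [uv dis me gr]]]].
have mU := measurable_realfun.open_measurable oU.
exists m.+1, (fun i => if (i < m)%N then u i else s),
  (fun i => if (i < m)%N then v i else s'); split => //.
- move=> i _; case: ltnP => [/uv[? [? ?]]|_]; split=> //; split=> //; lra.
- move=> i j /andP[ij]; rewrite ltnS leq_eqVlt => /orP[/eqP jm|jm].
    by rewrite jm ltnn -jm ij; case: (uv i) => [|_ []//]; rewrite -jm.
  by rewrite jm (ltn_trans ij jm); apply: dis; rewrite ij.
- rewrite big_ord_recr/= ltnn.
  under eq_bigr do rewrite ltn_ord.
  apply: (@le_trans _ _ (lebesgue_measure ((U `&` `[a, s[) `|` `[s, s'[))).
    rewrite measureU//; last 2 first.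
    + exact: measurableI.
    + rewrite -subset0 => x [[_]] /=; rewrite !in_itv/= => /andP[_ xs] /andP[sx _].
      by rewrite ltNge sx in xs.
    rewrite EFinD; apply: leeD => //.
    have := lebesgue_measure_itv `[s, s'[ => /= ->; rewrite lte_fin.
    case: ltP => [_|s's]; first by rewrite EFinB.
    by rewrite lee_fin subr_le0.
  apply: le_measure; rewrite ?inE//.
  + by apply: measurableU => //; exact: measurableI.
  + exact: measurableI.
  + move=> x [[Ux]|/[dup] /sU Ux] /=; rewrite !in_itv/= => /andP[h1 h2].
      by rewrite h1 (lt_le_trans h2 ss').
    by rewrite h2 (le_trans as_ h1).
- rewrite big_ord_recr/= ltnn.
  under eq_bigr do rewrite ltn_ord.
  (* The new absolute increment covers any decrease of [f] on [[s, s']]; the extra slope allowance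
     only weakens the bound. *)
  have := ler_norm (- (f s' - f s)); rewrite normrN.
  have : 0 <= e * (s' - s) by rewrite mulr_ge0// subr_ge0.
  lra.
Qed.

(** Outer regularity of Lebesgue measure, applied to a measurable null set containing the
    exceptional points. *)
Lemma ae_open_cover (R : realType) (P : set R) (d : R) :
  {ae @lebesgue_measure R, forall x, P x} -> 0 < d ->
  exists U : set R,
    [/\ open U, ~` P `<=` U & (lebesgue_measure U < d%:E)%E].
Proof.
move=> aeP d0.
have [Z [mZ Z0 PZ]] : exists Z : set R,
    [/\ measurable Z, lebesgue_measure Z = 0%E & ~` P `<=` Z].
  by case: aeP => Z [mZ Z0 PZ]; exists Z.
have muZ : (lebesgue_measure Z < +oo)%E by rewrite Z0.
have [U [oU ZU muU]] := lebesgue_regularity_outer mZ muZ d0.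
exists U; split => //; first exact: subset_trans ZU.
have mUZ := measurableD (measurable_realfun.open_measurable oU) mZ.
have := @measureU2 _ _ _ (@lebesgue_measure R) _ _ mZ mUZ.
rewrite setDUK// => /le_lt_trans; apply.
suff : (lebesgue_measure Z + lebesgue_measure (U `\` Z) < d%:E)%E by [].
by rewrite Z0 add0e.
Qed.

(** An open set [U] of small measure covers the bad points. Real induction builds a growth witness
    up to [b], stepping by an interval of [U] at points of [U] and by the derivative elsewhere. *)
Lemma abs_continuous_ge0_derive_le (R : realType) (a b : R) (f : R -> R) :
  a <= b -> abs_continuous a b f ->
  {ae @lebesgue_measure R, forall t, t \in `]a, b[ ->
     derivable f t 1 /\ 0 <= 'D_1 f t} ->
  f a <= f b.
Proof.
move=> leab acf aef; apply/ler_addgt0Pr => e e0.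
(* The slope loss [e' * (b - a)] and the loss [e'] from absolute continuity add up to [e]. *)
pose e' := e / (b - a + 1).
have e'0 : 0 < e' by apply: divr_gt0 => //; lra.
have [d d0 hd] := acf _ e'0.
(* The endpoints join the null set, so that every point of the closed interval outside [U] is good;
   points outside [[a, b]] need no covering. *)
have aef' : {ae @lebesgue_measure R, forall t,
    derivable f t 1 /\ 0 <= 'D_1 f t \/ t \notin `[a, b]}.
  have ae_ne c : {ae @lebesgue_measure R, forall t, t != c}.
    exists [set c]; split => //; first exact: lebesgue_measure_set1.
    by move=> t /= /negP/negPn/eqP.
  apply: filterS3 (ae_ne a) (ae_ne b) aef => t ta tb ft.
  case: (boolP (t \in `[a, b])) => tab; [left|by right].
  apply: ft; move: tab; rewrite !in_itv/= => /andP[le_at le_tb].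
  by rewrite !lt_neqAle eq_sym ta tb le_at.
have [U [oU PU muU]] := ae_open_cover R _ d aef' d0.
have [m [u [v [uv dis me gr]]]] : growth_witness R U f e' a b.
  apply: (@real_induction _ a b) => //.
    exists 0%N, (fun=> 0), (fun=> 0); split => //; rewrite ?big_ord0 ?measure_ge0//.
    by rewrite !subrr mulr0 subr0.
  move=> x xab; have [Ux|nUx] := pselect (U x).
    have [r /= r0 rU] : nbhs_ball x U by apply/nbhs_ballP; exact: oU.
    exists r => // s s' gs /andP[as_ sx] /andP[xs' s'b] xs s'x.
    apply: growth_witness_step_in gs => //; [exact: ltW|exact: le_trans xs'|].
    move=> y /=; rewrite in_itv/= => /andP[sy ys'].
    by apply: rU; rewrite -ball_normE /= ltr_norml; apply/andP; split; lra.
  have [df f'0] : derivable f x 1 /\ 0 <= 'D_1 f x.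
    have [//|] : derivable f x 1 /\ 0 <= 'D_1 f x \/ x \notin `[a, b].
      by apply: contrapT => nP; apply/nUx/PU.
    by rewrite in_itv/= xab.
  have [r r0 hr] := ge0_derive_local_growth _ _ _ _ df f'0 e'0.
  exists r => // s s' gs /andP[as_ sx] /andP[xs' s'b] xs s'x.
  apply: growth_witness_step_out gs => //; first exact: le_trans xs'.
  by apply: hr => //; rewrite sx.
(* The total length of the intervals is at most the measure of [U], hence below [d]. *)
have : \sum_(i < m) `|f (v i) - f (u i)| < e'.
  apply: hd => [i|i j ij|]; first exact: uv.
    move: ij; rewrite -val_eqE /= neq_ltn => /orP[ij|ji]; [left|right].
      by apply: dis; rewrite ij ltn_ord.
    by apply: dis; rewrite ji ltn_ord.
  rewrite -lte_fin; apply: le_lt_trans me _; apply: le_lt_trans muU.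
  have mU := measurable_realfun.open_measurable oU.
  by apply: le_measure; rewrite ?inE//; exact: measurableI.
have : e' * (b - a + 1) = e by rewrite divfK//; apply: lt0r_neq0; lra.
lra.
Qed.

(** * Nonpositivity by a backward comparison argument *)

(** The derivative is controlled only where [f] is positive, so monotonicity is applied between a
    supposed positive point [t0] and the first later point [t1] where [f] is nonpositive. *)
Lemma abs_continuous_le0 (R : realType) (a b : R) (f : R -> R) :
  abs_continuous a b f -> f b <= 0 ->
  {ae @lebesgue_measure R, forall t, t \in `]a, b[ -> 0 < f t ->
     derivable f t 1 /\ 0 <= 'D_1 f t} ->
  forall t, a <= t <= b -> f t <= 0.
Proof.
move=> acf fb aef t0 /andP[at0 t0b]; rewrite leNgt; apply/negP => ft0.
pose A := [set s | t0 <= s <= b /\ f s <= 0].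
have infA : has_inf A.
  by split; [exists b; split; rewrite ?t0b ?lexx | exists t0 => s [/andP[]]].
set t1 := inf A.
have t0t1 : t0 <= t1 by apply: lb_le_inf; [case: infA | move=> s [/andP[]]].
have t1b : t1 <= b by apply: ge_inf; [case: infA | split; rewrite ?t0b ?lexx].
have pos s : t0 <= s -> s < t1 -> 0 < f s.
  move=> t0s st1; rewrite ltNge; apply/negP => fs.
  have : t1 <= s.
    by apply: ge_inf; [case: infA | split; rewrite // t0s (le_trans (ltW st1))].
  by rewrite leNgt st1.
(* Were [f t1] positive, points of [A] close to [t1] would have values within [f t1] of it, hence
   positive. *)
have ft1 : f t1 <= 0.
  rewrite leNgt; apply/negP => /[dup] ft1.
  move=> /(abs_continuous_dist _ _ _ _ acf)[d d0 hd].
  have [s As sd] := inf_adherent d0 infA.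
  have t1s : t1 <= s by apply: ge_inf => //; case: infA.
  case: As => /andP[_ sb] fs.
  have := hd t1 s (le_trans at0 t0t1) t1s sb.
  by rewrite ltrBlDl => /(_ sd); rewrite ltr_norml => /andP[]; lra.
suff : f t0 <= f t1 by lra.
apply: abs_continuous_ge0_derive_le => //.
  exact: abs_continuous_sub acf.
apply: (@filterS _ _ (ae_filter_ringOfSetsType _) _ _ _ aef) => t + tt1; apply.
  move: tt1; rewrite !in_itv/= => /andP[? ?]; apply/andP; split; lra.
by move: tt1; rewrite in_itv/= => /andP[? ?]; apply: pos => //; exact: ltW.
Qed.

(** * Comparison of the right-hand sides of the two equations *)

Section Model.
Context {R : realType} {L N K : nat} (M : model R L N K).
Context (x : 'I_K -> assortment N -> R).

Local Notation q k n := (choice_prob M k (A_static x k) n).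

Lemma choice_prob_A_static_ge0 : cdlp_feasible M x -> forall k n, 0 <= q k n.
Proof.
move=> [_ x1 x0] k n; apply: sumr_ge0 => S nS; apply: mulr_ge0; last first.
  exact: choice_ge0.
by rewrite addr_ge0// mulr_ge0// subr_ge0.
Qed.

(** For an empty resource the opportunity cost is [+oo], but the zero indicator cancels the term, so
    only finite quantities remain. *)
Lemma FCFS_rateE (V : inventory L -> R -> R) (c : inventory L) (t : R) :
  (\sum_(k < K) \sum_(l < L)
     (0 < c l)%N%:R%:E * Rrate M k l t (A_static x k) (Delta V l c t))%E =
  (\sum_(k < K) \sum_(l < L | (0 < c l)%N) rate M k t *
     \sum_(n in products_of M l)
       q k n * (reward M n - (V c t - V (deplete c l) t)))%:E.
Proof.
rewrite -sumEFin; apply: eq_bigr => k _; rewrite -sumEFin [RHS]big_mkcond.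
apply: eq_bigr => l _; rewrite /Rrate /Delta; case: ifP => _; last by rewrite mul0e.
by rewrite mul1e EFinM -sumEFin; congr (_ * _)%E.
Qed.

(** Here no indicator is present: an infinite opportunity cost makes the positive part vanish. *)
Lemma PR_rateE (V : inventory L -> R -> R) (c : inventory L) (t : R) :
  (\sum_(k < K) \sum_(l < L)
     Rrate_pos M k l t (A_static x k) (Delta V l c t))%E =
  (\sum_(k < K) \sum_(l < L | (0 < c l)%N) rate M k t *
     \sum_(n in products_of M l)
       q k n * Num.max (reward M n - (V c t - V (deplete c l) t)) 0)%:E.
Proof.
rewrite -sumEFin; apply: eq_bigr => k _; rewrite -sumEFin [RHS]big_mkcond.
apply: eq_bigr => l _; rewrite /Rrate_pos /Delta; case: ifP => _; last first.
  by rewrite big1 ?mule0// => n _; rewrite addeNy maxNye mule0.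
rewrite EFinM -sumEFin; congr (_ * _)%E; apply: eq_bigr => n _.
by rewrite EFinM EFin_max.
Qed.

Lemma is_state_deplete (c : inventory L) l :
  is_state M c -> is_state M (deplete c l).
Proof.
by move=> hc j; rewrite ffunE; apply: leq_trans (hc j); exact: leq_subr.
Qed.

Lemma sum_deplete_lt (c : inventory L) l : (0 < c l)%N ->
  (\sum_j deplete c l j < \sum_j c j)%N.
Proof.
move=> cl; rewrite (bigD1 l)//= [X in (_ < X)%N](bigD1 l)//= -addSn leq_add//.
  by rewrite ffunE eqxx subn1 prednK.
by apply: leq_sum => j _; rewrite ffunE leq_subr.
Qed.

(* Each PR term is at least [r_n - Delta_l W], and [Delta_l W <= Delta_l V]
   under the two order hypotheses. *)
Lemma FCFS_rate_le_PR_rate (V W : inventory L -> R -> R) (c : inventory L) (t : R) :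
  cdlp_feasible M x -> 0 <= t <= 1 -> W c t <= V c t ->
  (forall l, (0 < c l)%N -> V (deplete c l) t <= W (deplete c l) t) ->
  \sum_(k < K) \sum_(l < L | (0 < c l)%N) rate M k t *
    \sum_(n in products_of M l)
      q k n * (reward M n - (V c t - V (deplete c l) t)) <=
  \sum_(k < K) \sum_(l < L | (0 < c l)%N) rate M k t *
    \sum_(n in products_of M l)
      q k n * Num.max (reward M n - (W c t - W (deplete c l) t)) 0.
Proof.
move=> feas t01 WV VW; apply: ler_sum => k _; apply: ler_sum => l cl.
apply: ler_wpM2l; first exact: rate_ge0.
apply: ler_sum => n _; apply: ler_wpM2l; first exact: choice_prob_A_static_ge0.
by rewrite le_max; apply/orP; left; have := VW l cl; lra.
Qed.

End Model.

(** * Induction on total inventory *)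

Theorem theorem7 (R : realType) (L N K : nat) (M : model R L N K)
    (eps : R) (heps : 0 <= eps)
    (x : 'I_K -> assortment N -> R) (hx : cdlp_eps_optimal M eps x)
    (V_FCFS V_PR : inventory L -> R -> R)
    (hFCFS : is_FCFS_value M x V_FCFS) (hPR : is_PR_value M x V_PR)
    (c : inventory L) (hc : is_state M c) (t : R) (ht : 0 <= t <= 1) :
  V_FCFS c t <= V_PR c t.
Proof.
case: hx => feas _.
case: hFCFS hPR => [acV odeV _ V1] [acW odeW _ W1].
have [m] := ubnP (\sum_l c l)%N.
elim: m c hc t ht => // m IH c hc t ht; rewrite ltnS => cm.
suff : (V_FCFS c - V_PR c) t <= 0 by rewrite subr_le0.
apply: (abs_continuous_le0 _ 0 1) => //.
- by apply: abs_continuousB; [exact: acV | exact: acW].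
- by rewrite !fctE V1// W1// subrr.
apply: (@filterS2 _ _ (ae_filter_ringOfSetsType _) _ _ _ _ (odeV c hc) (odeW c hc)).
move=> s hV hW s01; have [dV eV] := hV s01; have [dW eW] := hW s01.
rewrite !fctE subr_gt0 => WV; split; first exact: derivableB.
(* Both derivatives are minus the rates, so nonnegativity of the derivative of the difference
   becomes: FCFS rate at most PR rate. *)
rewrite deriveB// subr_ge0 -lee_fin eV eW leeN2 FCFS_rateE PR_rateE lee_fin.
move: s01; rewrite in_itv/= => /andP[/ltW s0 /ltW s1].
apply: FCFS_rate_le_PR_rate => //; [by rewrite s0 | exact: ltW |].
move=> l cl; apply: IH; [exact: is_state_deplete | by rewrite s0 |].
exact: leq_trans (sum_deplete_lt _ _ cl) cm.
Qed.
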